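(* There is a one-to-one correspondence between latin rumples and involutive set-theoretic solutions $r=(r_1,r_2)$ of the Yang-Baxter equation in which both $r_1$ and $r_2$ are quasigroup operations.
   Context: A set-theoretic solution of the Yang-Baxter equation over a set $X$ is a mapping $r:X\times X\to X\times X$ such that $(r\times 1)(1\times r)(r\times 1)=(1\times r)(r\times 1)(1\times r)$ holds as an equality of mappings $X\times X\times X\to X\times X\times X$. Write $r(x,y)=(r_1(x,y),r_2(x,y))$, so that $r_1$ and $r_2$ are binary operations on $X$. The solution $r$ is involutive if $r^2=\mathrm{id}_{X\times X}$. A binary algebra $(X,\cdot)$ is a left quasigroup if all left translations $L_x:y\mapsto x\cdot y$ are bijections of $X$. It is a quasigroup (and $\cdot$ is then a quasigroup operation) if, moreover, all right translations $R_x:y\mapsto y\cdot x$ are bijections of $X$. A rumple is a left quasigroup $(X,\cdot)$ in which the squaring map $x\mapsto x\cdot x$ is a bijection of $X$ and the identity $(x\cdot y)\cdot(x\cdot z)=(y\cdot x)\cdot(y\cdot z)$ holds. A latin rumple is a rumple that is a quasigroup. *)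

(* Defs.v *)
From mathcomp Require Import all_boot.
Set Implicit Arguments.
Unset Strict Implicit.
Unset Printing Implicit Defensive.

Section Algebra.
Variable X : Type.

Definition left_quasigroup (op : X -> X -> X) : Prop :=
  forall x, bijective (op x).

Definition quasigroup (op : X -> X -> X) : Prop :=
  left_quasigroup op /\ forall x, bijective (op^~ x).

Definition rumple (op : X -> X -> X) : Prop :=
  [/\ left_quasigroup op,
      bijective (fun x => op x x)
    & forall x y z, op (op x y) (op x z) = op (op y x) (op y z)].

Definition latin_rumple (op : X -> X -> X) : Prop :=
  rumple op /\ quasigroup op.

End Algebra.

Section YangBaxter.
Variable X : Type.
Implicit Type r : X * X -> X * X.

Definition r1 r (x y : X) : X := (r (x, y)).1.
Definition r2 r (x y : X) : X := (r (x, y)).2.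

(* [X * X * X] is [(X * X) * X], so [id_times] has to reassociate. *)
Definition times_id r (t : X * X * X) : X * X * X :=
  let: (x, y, z) := t in (r (x, y), z).
Definition id_times r (t : X * X * X) : X * X * X :=
  let: (x, y, z) := t in (x, (r (y, z)).1, (r (y, z)).2).

Definition yang_baxter r : Prop :=
  times_id r \o id_times r \o times_id r
    =1 id_times r \o times_id r \o id_times r.

Definition latin_involutive_solution r : Prop :=
  [/\ yang_baxter r, involutive r, quasigroup (r1 r) & quasigroup (r2 r)].

End YangBaxter.

(* Main.v *)
Require Import Defs.
From mathcomp Require Import all_boot.
From mathcomp.classical Require Import boolp.
Set Implicit Arguments.
Unset Strict Implicit.
Unset Printing Implicit Defensive.

(** A rumple and its solution determine each other through
    r (x, x * u) = (u, u * x), which is involutive on sight. On a triple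
    (x, x * u, (x * u) * (x * v)) the second Yang-Baxter composite is
    computed with the rumple identity, and so is the first; both equal
    (v, v * u, (v * u) * (v * x)). Comparing first components gives back the
    rumple identity. Finally the right translations of r2 correspond to the
    squaring map: x * u = y and u * x = z force y * (x * x) = z * z. *)

Lemma inj_surj_bijective (A B : Type) (f : A -> B) :
  injective f -> (forall b, exists a, f a = b) -> bijective f.
Proof.
move=> f_inj /choice[g gK]; exists g => // a.
exact/f_inj/gK.
Qed.

Lemma bijective_surj (A B : Type) (f : A -> B) :
  bijective f -> forall b, exists a, f a = b.
Proof. by case=> g _ gK b; exists (g b). Qed.

Lemma sval_inj (A : Type) (P : A -> Prop) : injective (@proj1_sig A P).
Proof. by move=> [a Pa] [b Pb] /=; apply: eq_exist. Qed.

Section Correspondence.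
Variable X : Type.
Implicit Types (op : X -> X -> X) (r : X * X -> X * X).

(** A relation rather than a formula for [r]: it names no left division and can be read from either
    side. *)
Definition linked op r : Prop := forall x u, r (x, op x u) = (u, op u x).

Lemma linked_div op r x y : left_quasigroup op -> linked op r ->
  op x (r1 r x y) = y /\ r2 r x y = op (r1 r x y) x.
Proof.
move=> opL lk; have [u <-] := bijective_surj (opL x) y.
by rewrite /r1 /r2 lk.
Qed.

Lemma linked_r_exists op : left_quasigroup op -> exists r, linked op r.
Proof.
move=> opL.
have [g gE] := choice (fun p : X * X => bijective_surj (opL p.1) p.2).
exists (fun p => (g p, op (g p) p.1)) => x u /=.
by congr pair; [|congr (op _ x)]; apply: (bij_inj (opL x)); rewrite (gE (x, _)).
Qed.

Lemma linked_op_exists r :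
  involutive r -> left_quasigroup (r1 r) -> exists op, linked op r.
Proof.
move=> rK rL.
have [g gE] := choice (fun p : X * X => bijective_surj (rL p.1) p.2).
exists (fun x u => g (x, u)) => x u /=.
have := gE (x, u); have := rK (x, g (x, u)).
rewrite /r1 /=; case: (r (x, _)) => a b rab /= eq_a; rewrite eq_a in rab *.
(* By involutivity [r (u, b) = (x, g (x, u))], so [b] solves the equation [r1 r u b = x] that
   defines [g (u, x)]. *)
congr pair; apply: (bij_inj (rL u)).
by rewrite (gE (u, x)) /r1 rab.
Qed.

Lemma linked_r_unique op r r' :
  left_quasigroup op -> linked op r -> linked op r' -> r = r'.
Proof.
move=> opL lk lk'; apply: funext => -[x y].
by have [u <-] := bijective_surj (opL x) y; rewrite lk lk'.
Qed.

Lemma linked_op_unique op op' r :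
  left_quasigroup (r1 r) -> linked op r -> linked op' r -> op = op'.
Proof.
move=> rL lk lk'; apply: funext => x; apply: funext => u.
by apply: (bij_inj (rL x)); rewrite /r1 lk lk'.
Qed.

Lemma linked_solution op r :
  latin_rumple op -> linked op r -> latin_involutive_solution r.
Proof.
move=> [[opL sq rum] [_ opR]] lk.
have lkE x y : exists u, op x u = y by apply: (bijective_surj (opL x)).
have r1E x u : r1 r x (op x u) = u by rewrite /r1 lk.
have r2E x u : r2 r x (op x u) = op u x by rewrite /r2 lk.
have r1K x y : op x (r1 r x y) = y by case: (linked_div x y opL lk).
split.
- move=> [[x y] z]; have [u <-] := lkE x y.
  have [w <-] := lkE (op x u) z; have [v <-] := lkE x w.
  have t12 a b c : times_id r (a, op a b, c) = (b, op b a, c).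
    by rewrite /times_id lk.
  have t23 a b c : id_times r (a, b, op b c) = (a, c, op c b).
    by rewrite /id_times lk.
  transitivity (v, op v u, op (op v u) (op v x)); rewrite /comp.
    by rewrite t12 (rum x u v) t23 t12 (rum u v x).
  by rewrite t23 t12 (rum x v u) t23.
- by move=> [x y]; have [u <-] := lkE x y; rewrite !lk.
- split=> [x | y].
    by apply: (bij_can_bij (opL x)) => u; rewrite r1E.
  (* Since [r1 r x y = u] means [op x u = y], bijectivity of [op^~ u] gives exactly one [x] for each
     [u]. *)
  apply: inj_surj_bijective => [x x' /= eq_u | u].
    by apply: (bij_inj (opR (r1 r x y))); rewrite /= {2}eq_u !r1K.
  by have [x <-] := bijective_surj (opR u) y; exists x; rewrite /= r1E.
- split=> [x | y].
    apply: (@eq_bij _ _ (op^~ x \o r1 r x)) => [|y].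
      apply: bij_comp => //.
      by apply: (bij_can_bij (opL x)) => u; rewrite r1E.
    by have [u <-] := lkE x y; rewrite /= r1E r2E.
  have sqE x u : op (op x u) (op x x) = op (op u x) (op u x) by rewrite rum.
  apply: inj_surj_bijective => [x x' /= | z].
    have [u eq_y] := lkE x y; have [u' eq_y'] := lkE x' y.
    rewrite -{1}eq_y -eq_y' !r2E => eq_z.
    apply: (bij_inj sq) => /=; apply: (bij_inj (opL y)).
    by rewrite -{1}eq_y -eq_y' !sqE eq_z.
  (* Solve [sqE] backwards: [s] is the value that [op x x] must take, [x] its square root, and [u]
     the left quotient of [y] by [x]. *)
  have [s eq_s] := lkE y (op z z); have [x eq_x] := bijective_surj sq s.
  have [u eq_y] := lkE x y; exists x => /=.
  rewrite -eq_y r2E; apply: (bij_inj sq) => /=.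
  by rewrite -sqE eq_y eq_x.
Qed.

Lemma linked_rumple op r :
  latin_involutive_solution r -> linked op r -> latin_rumple op.
Proof.
move=> [yb _ [r1L r1R] [_ r2R]] lk.
have r1E x u : r1 r x (op x u) = u by rewrite /r1 lk.
have r2E x u : r2 r x (op x u) = op u x by rewrite /r2 lk.
have opL : left_quasigroup op.
  by move=> x; apply: (bij_can_bij (r1L x)) => y; apply: (bij_inj (r1L x)).
have r1K x y : op x (r1 r x y) = y by case: (linked_div x y opL lk).
split; last split=> // u.
- split=> //.
    (* If [op x x = y] then [r2 r x y = y], and the right translation of [r2 r] by [y] takes the
       value [y] only once. *)
    apply: inj_surj_bijective => [x x' /= eq_y | y].
      by apply: (bij_inj (r2R (op x x))); rewrite /= r2E eq_y r2E.
    have [x /= eq_y] := bijective_surj (r2R y) y; exists x.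
    have [u xu] := bijective_surj (opL x) y.
    have ux : op u x = y by rewrite -r2E xu.
    (* As [op x u = y = op u x], that translation sends both [x] and [u] to [y]; hence they coincide
       and [x] is a square root of [y]. *)
    suff eq_u : u = x by rewrite -{2}eq_u.
    by apply: (bij_inj (r2R y)); rewrite /= eq_y -{1}ux r2E.
  move=> x u v; set z := op _ (op x v).
  (* First components say that dividing [z] on the left by [op u x], and the result by [u], yields
     [v]; multiplying back is the rumple identity. *)
  have /(congr1 (fun t => t.1.1)) := yb (x, op x u, z).
  rewrite /= !lk /=.
  rewrite -/(r1 r (op u x) z) -/(r1 r u _) => <-.
  by rewrite !r1K.
- apply: inj_surj_bijective => [x x' /= eq_y | y].
    by apply: (bij_inj (r1R (op x u))); rewrite /= r1E eq_y r1E.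
  by have [x /= <-] := bijective_surj (r1R y) u; exists x; rewrite r1K.
Qed.

End Correspondence.

(* The second conjunct identifies the correspondence: writing x \ y for the
   solution u of x * u = y, it sends * to r(x, y) = (x \ y, (x \ y) * x). *)
Theorem theorem3p2 (X : Type) :
  exists F : {op : X -> X -> X | latin_rumple op} ->
             {r : X * X -> X * X | latin_involutive_solution r},
    bijective F /\
    forall (Q : {op : X -> X -> X | latin_rumple op}) (x y : X),
      sval Q x (r1 (sval (F Q)) x y) = y /\
      r2 (sval (F Q)) x y = sval Q (r1 (sval (F Q)) x y) x.
Proof.
have rumpleL (Q : {op : X -> X -> X | latin_rumple op}) :
  left_quasigroup (sval Q) by case: (svalP Q) => [[]].
have solutionL (S : {r : X * X -> X * X | latin_involutive_solution r}) :
  left_quasigroup (r1 (sval S)) by case: (svalP S) => _ _ [].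
have /choice[F lkF] (Q : {op : X -> X -> X | latin_rumple op}) :
    exists S : {r : X * X -> X * X | latin_involutive_solution r},
      linked (sval Q) (sval S).
  have [r lk] := linked_r_exists (rumpleL Q).
  by exists (exist _ r (linked_solution (svalP Q) lk)).
exists F; split=> [|Q x y]; last exact: linked_div.
(* Uniqueness of the linked [op] makes [F] injective; existence of [op] for a given [S], with
   uniqueness of the linked [r], makes it surjective. *)
apply: inj_surj_bijective => [Q Q' eqF | S].
  apply/sval_inj/(linked_op_unique (solutionL (F Q)) (lkF Q)).
  by rewrite eqF.
have [_ rK _ _] := svalP S.
have [op lk] := linked_op_exists rK (solutionL S).
exists (exist _ op (linked_rumple (svalP S) lk)).
exact/sval_inj/(linked_r_unique (rumpleL _) (lkF _)).
Qed.
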